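(* For every $n\in\mathbb{N}_0=\{0,1,2,\dots\}$ and every real $t>0$, let $$m_n(t):=\int_{\mathbb{R}}x^n\,d\left(\mu_{\mathrm{sc},2\sqrt{t}}\boxplus\mathrm{Unif}_{[-t,0]}\right)(x).$$ Then $$m_n(t)=n!\sum_{j=\lceil n/2\rceil}^{n}\frac{t^j}{j!\,(1+j)!}\,s(1+j,\,n+1-j),$$ where $s(\cdot,\cdot)$ denotes the signed Stirling numbers of the first kind.
   Context: $\mu_{\mathrm{sc},R}$ denotes the semicircle distribution with radius $R>0$, i.e. the probability measure on $[-R,R]$ with density $\frac{2}{\pi R^2}\sqrt{R^2-x^2}$ (so $\mu_{\mathrm{sc},2\sqrt{t}}$ has mean $0$ and variance $t$). $\mathrm{Unif}_I$ is the uniform probability distribution on the interval $I$. $\boxplus$ denotes the free additive convolution of probability measures on $\mathbb{R}$. The signed Stirling numbers of the first kind $s(n,k)$ are defined by $x^{(n)}=\sum_{k=0}^{n}(-1)^{n-k}s(n,k)x^k$, where $x^{(n)}=\prod_{i=0}^{n-1}(x+i)$ is the rising factorial; $s(n,k)=0$ for $k>n$. *)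

(* Defs.v *)
From HB Require Import structures.
From mathcomp Require Import all_boot all_order all_algebra.
From mathcomp Require Import all_classical all_reals all_analysis.
From mathcomp Require Import measurable_realfun.
From mathcomp.real_closed Require Import complex.
From mathcomp Require Import ring.

Set Implicit Arguments.
Unset Strict Implicit.
Unset Printing Implicit Defensive.

Import Order.TTheory GRing.Theory Num.Theory.
Import numFieldNormedType.Exports.

Local Open Scope classical_set_scope.
Local Open Scope ring_scope.

(* Coefficient extraction in x^(n) = \sum_k (-1)^(n-k) s(n,k) x^k. The
   truncated subtraction is harmless: the coefficient is 0 for k > n. *)
Definition stirling1 (n k : nat) : int :=
  (-1) ^+ (n - k) * (\prod_(i < n) ('X + i%:R%:P) : {poly int})`_k.

Section semicircle.
Context {R : realType} (r : R).
Local Notation mu := (@lebesgue_measure R).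

Definition semicircle_pdf (x : R) : R :=
  if - r <= x <= r then 2 / (pi * r ^+ 2) * Num.sqrt (r ^+ 2 - x ^+ 2) else 0.

Definition semicircle_prob (r0 : 0 < r) : set (measurableTypeR R) -> \bar R :=
  fun A => (\int[mu]_(x in A) (semicircle_pdf x)%:E)%E.

Lemma semicircle_pdf_ge0 x : 0 <= semicircle_pdf x.
Proof.
rewrite /semicircle_pdf; case: ifPn => // _.
by rewrite mulr_ge0 ?sqrtr_ge0// divr_ge0// mulr_ge0 ?pi_ge0 ?sqr_ge0.
Qed.

Let continuous_sqrt_circle :
  continuous (fun x : R => Num.sqrt (r ^+ 2 - x ^+ 2)).
Proof.
move=> x; apply: (@continuous_comp R R R (fun x => r ^+ 2 - x ^+ 2) Num.sqrt).
  apply: continuousB; first exact: cst_continuous.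
  exact: exprn_continuous.
exact: sqrt_continuous.
Qed.

Lemma measurable_semicircle_pdf : measurable_fun setT semicircle_pdf.
Proof.
apply: measurable_fun_if => //=.
  by apply: measurable_and => //; exact: measurable_fun_ler.
apply: measurable_funTS; apply: measurable_funM => //.
by apply: continuous_measurable_fun; exact: continuous_sqrt_circle.
Qed.

Hypothesis r0 : 0 < r.

Let integral_semicircle_pdf :
  (\int[mu]_(x in `[(- r)%R, r]) (Num.sqrt (r ^+ 2 - x ^+ 2))%:E =
   (pi * r ^+ 2 / 2)%:E)%E.
Proof.
have dF (x : R) : is_derive x 1 (fun x : R => r * sin x) (r * cos x).
  exact: is_derive_eq.
have F'E : derive1 (fun x : R => r * sin x) = (fun x => r * cos x).
  by apply/funext => x; rewrite derive1E; apply: derive_val.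
have pihalf0 : 0 < pi / 2 :> R by rewrite divr_gt0// pi_gt0.
have npi_lt : - (pi / 2) < pi / 2 :> R.
  by rewrite (@lt_trans _ _ 0)// oppr_lt0.
have cF : continuous (fun x : R => r * sin x).
  by move=> x; apply: cvgM; [exact: cvg_cst|exact: continuous_sin].
have cF' : continuous (fun x : R => r * cos x).
  by move=> x; apply: cvgM; [exact: cvg_cst|exact: continuous_cos].
have /= := @integration_by_substitution_increasing R
  (fun x => r * sin x) (fun x => Num.sqrt (r ^+ 2 - x ^+ 2))
  (- (pi / 2)) (pi / 2).
rewrite sinN sin_pihalf mulrN mulr1 => ->.
- have dG (x : R) : is_derive x 1
      (fun x : R => (r ^+ 2 / 2) * (x + sin x * cos x)) (r ^+ 2 * cos x ^+ 2).
    apply: is_derive_eq; rewrite /GRing.scale /= mulrN -expr2 sin2cos2.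
    by field.
  have cG : continuous (fun x : R => r ^+ 2 * cos x ^+ 2).
    move=> x; apply: cvgM; first exact: cvg_cst.
    by apply: (@continuous_comp R R R cos (fun y => y ^+ 2));
      [exact: continuous_cos|exact: exprn_continuous].
  rewrite (_ : (\int[mu]_(x in _) _)%E =
     (\int[mu]_(x in `[(- (pi / 2))%R, (pi / 2)%R]) (r ^+ 2 * cos x ^+ 2)%:E)%E).
    rewrite (@continuous_FTC2 _ _
      (fun x : R => (r ^+ 2 / 2) * (x + sin x * cos x))).
    + rewrite cosN cos_pihalf -EFinD; congr EFin; by field.
    + exact: npi_lt.
    + exact: continuous_subspaceT.
    + have cGG : continuous (fun x : R => (r ^+ 2 / 2) * (x + sin x * cos x)).
        move=> x; apply: differentiable_continuous; apply/derivable1_diffP.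
        by apply: ex_derive.
      split.
      * by move=> x _; apply: ex_derive.
      * exact/cvg_at_right_filter/cGG.
      * exact/cvg_at_left_filter/cGG.
    + by move=> x _; rewrite derive1E; apply: derive_val.
  apply: eq_integral => x; rewrite inE/= in_itv/= => xpi.
  rewrite /= F'E; congr EFin.
  rewrite [LHS](_ : _ = Num.sqrt (r ^+ 2 - (r * sin x) ^+ 2) * (r * cos x))//.
  rewrite (_ : r ^+ 2 - (r * sin x) ^+ 2 = (r * cos x) ^+ 2); last first.
    by rewrite !exprMn cos2sin2; ring.
  rewrite sqrtr_sqr ger0_norm; first by ring.
  by rewrite mulr_ge0// ?(ltW r0)// cos_ge0_pihalf.
- exact: ltW npi_lt.
- by move=> x y xI yI xy; rewrite ltr_pM2l// ltr_sin.
- by move=> x _; rewrite F'E; exact: cF'.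
- by rewrite F'E; apply/cvg_ex; eexists; apply/cvg_at_right_filter; exact: cF'.
- by rewrite F'E; apply/cvg_ex; eexists; apply/cvg_at_left_filter; exact: cF'.
- split.
  + by move=> x _; apply: ex_derive.
  + exact/cvg_at_right_filter/cF.
  + exact/cvg_at_left_filter/cF.
- exact: continuous_subspaceT.
Qed.

Let semicircle0 : semicircle_prob r0 set0 = 0%E.
Proof. by rewrite /semicircle_prob integral_set0. Qed.

Let semicircle_ge0 A : (0 <= semicircle_prob r0 A)%E.
Proof.
by apply: integral_ge0 => /= x _; rewrite lee_fin semicircle_pdf_ge0.
Qed.

Let semicircle_sigma_additive : semi_sigma_additive (semicircle_prob r0).
Proof.
move=> /= F mF tF mUF; rewrite /semicircle_prob; apply: cvg_toP.
  apply: ereal_nondecreasing_is_cvgn => m n mn.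
  apply: lee_sum_nneg_natr => // k _ _.
  by apply: integral_ge0 => /= x _; rewrite lee_fin semicircle_pdf_ge0.
rewrite ge0_integral_bigcup//=.
- apply: measurable_funTS; apply: measurableT_comp => //.
  exact: measurable_semicircle_pdf.
- by move=> x _; rewrite lee_fin semicircle_pdf_ge0.
Qed.

HB.instance Definition _ := isMeasure.Build _ _ _ (semicircle_prob r0)
  semicircle0 semicircle_ge0 semicircle_sigma_additive.

Let semicircle_setT : semicircle_prob r0 [set: _] = 1%:E.
Proof.
rewrite /semicircle_prob.
transitivity (\int[mu]_(x in `[(- r)%R, r])
    ((2 / (pi * r ^+ 2))%:E * (Num.sqrt (r ^+ 2 - x ^+ 2))%:E))%E.
  rewrite [RHS]integral_mkcond; apply: eq_integral => x _.
  rewrite patchE /semicircle_pdf; case: ifPn => h; case: ifPn => //.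
    by rewrite notin_setE/= in_itv/= h.
  by rewrite inE/= in_itv/= (negbTE h).
rewrite ge0_integralZl//=.
- rewrite integral_semicircle_pdf -EFinM; congr EFin.
  have := lt0r_neq0 (pi_gt0 R); move: (pi) => p p0.
  by field; rewrite p0 (lt0r_neq0 r0).
- apply/measurable_EFinP/measurable_funTS.
  by apply: continuous_measurable_fun; exact: continuous_sqrt_circle.
- by rewrite lee_fin divr_ge0// mulr_ge0 ?pi_ge0 ?sqr_ge0.
Qed.

HB.instance Definition _ := @Measure_isProbability.Build _ _ R
  (semicircle_prob r0) semicircle_setT.

End semicircle.

Lemma two_sqrt_gt0 {R : realType} (t : R) : 0 < t -> 0 < 2 * Num.sqrt t.
Proof. by move=> t0; rewrite mulr_gt0// sqrtr_gt0. Qed.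

Lemma opp_lt0 {R : realType} (t : R) : 0 < t -> - t < 0.
Proof. by rewrite oppr_lt0. Qed.

Local Notation prob R := (probability (measurableTypeR R) R).

Definition moment {R : realType} (mu : prob R) (n : nat) : \bar R :=
  (\int[mu]_x (x ^+ n)%:E)%E.

Definition compactly_supported {R : realType} (mu : prob R) : Prop :=
  exists M : R, mu (~` `[- M, M]) = 0%E.

(* A *-probability space: a unital complex *-algebra with a positive unital
   linear functional. *)
Record starProbSpace (R : realType) := StarProbSpace {
  sps_alg :> algType R[i];
  star : sps_alg -> sps_alg;
  state : {linear sps_alg -> R[i]^o};
  starK : involutive star;
  starM : forall a b, star (a * b) = star b * star a;
  star_semilinear : forall (c : R[i]) a b,
    star (c *: a + b) = conjc c *: star a + star b;
  state1 : state 1 = 1;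
  state_ge0 : forall a, 0 <= state (star a * a)
}.

Section noncommutative_probability.
Context {R : realType} {A : starProbSpace R}.

Definition selfadjoint (X : A) : Prop := star X = X.

Definition free_family (I : eqType) (B : I -> set A) : Prop :=
  forall s : seq (I * A), s != [::] ->
    sorted (fun u v => u.1 != v.1) s ->
    (forall u, u \in s -> B u.1 u.2 /\ state A u.2 = 0) ->
    state A (\prod_(u <- s) u.2) = 0.

(* The unital subalgebra C[X] generated by X; it is a *-subalgebra when X is
   selfadjoint. *)
Definition gen_alg (X : A) : set A :=
  range (fun p : {poly R[i]} => horner_alg X p).

Definition freely_independent (X Y : A) : Prop :=
  free_family (fun b : bool => if b then gen_alg X else gen_alg Y).

(* Compact support makes every moment finite, so that fine loses nothing, and
   makes mu the only compactly supported measure satisfying this predicate. *)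
Definition has_law (X : A) (mu : prob R) : Prop :=
  compactly_supported mu /\
  forall n : nat, state A (X ^+ n) = (fine (moment mu n))%:C%C.

End noncommutative_probability.

(* lambda = mu [+] nu for compactly supported mu and nu: lambda is the law of
   X + Y, where X and Y are freely independent with laws mu and nu. Freeness
   determines the moments of X + Y, so lambda is determined by mu and nu. *)
Definition is_free_additive_convolution {R : realType}
    (mu nu lambda : prob R) : Prop :=
  exists (A : starProbSpace R) (X Y : A),
    [/\ selfadjoint X, selfadjoint Y, freely_independent X Y &
        [/\ has_law X mu, has_law Y nu & has_law (X + Y) lambda]].

(* Main.v *)
Require Import Defs.
From HB Require Import structures.
From mathcomp Require Import all_boot all_order all_algebra.
From mathcomp Require Import all_classical all_reals all_analysis.
From mathcomp Require Import measurable_realfun.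
From mathcomp.real_closed Require Import complex.
From mathcomp Require Import ring zify lra.

(** Write [phi] for the state, [S = X + Y], and work with formal power series in
a variable [g].  Put [b = t g / (e^(t g) - 1)], [U = 1 + t g^2 - g X] and
[V = b - g Y].  The moments of the semicircle and of the uniform law give
[phi (U^-1) = phi (V^-1) = 1], so that [x = U^-1 - 1] and [y = V^-1 - 1] have
centered coefficients.  Since [U + V - 1 = U (1 - x y) V],
[(U + V - 1)^-1 = (1 + y) (1 - x y)^-1 (1 + x)],
which is [1] plus a sum of alternating products of [x] and [y]; by freeness
[phi ((psi - g S)^-1) = 1] with [psi = b + t g^2].  This says that
[sum_n m_n w^(n+1) = g] for [w = g / psi], and Lagrange inversion gives
[(n + 1) m_n = [g^n] psi^(n+1)].  The coefficients of the powers of [b] are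
Stirling numbers (Norlund). *)

Set Implicit Arguments.
Unset Strict Implicit.
Unset Printing Implicit Defensive.

Import Order.TTheory GRing.Theory Num.Theory.
Import numFieldNormedType.Exports.
Local Open Scope ring_scope.

(** * Moments of the two laws *)

Section Analysis.
Local Open Scope classical_set_scope.
Context {R : realType}.
Local Notation leb := (@lebesgue_measure R).
Local Notation prob := (probability (measurableTypeR R) R).
Implicit Types (nu : prob) (a b : R).

(** The complement of [[-M, M]] is negligible, and on that segment the power is bounded. The sign of
    [M] is free, hence the bound [|M| ^+ n]. *)
Lemma integrable_expr nu n : compactly_supported nu ->
  nu.-integrable [set: R] (fun x => (x ^+ n)%:E).
Proof.
move=> [M nuM].
have mX (D : set R) : measurable_fun D (fun x : R => x ^+ n).
  by apply: measurable_funTS; exact: exprn_measurable.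
have mI : measurable (~` `[- M, M] : set (measurableTypeR R)).
  by apply: measurableC.
apply/(negligible_integrable mI _ _ nuM) => //.
  exact/measurable_EFinP.
rewrite setTD setCK.
apply: (@measurable_bounded_integrable _ _ _ nu (fun x => x ^+ n)) => //=.
  by rewrite (le_lt_trans (probability_le1 nu _))// ltry.
exists (`|M| ^+ n); split; first exact: num_real.
move=> y My x /=; rewrite in_itv/= => /andP[Mx xM].
rewrite (le_trans _ (ltW My))// normrX lerXn2r ?nnegrE//.
rewrite (le_trans _ (ler_norm M))// ler_norml; lra.
Qed.

(** Such a measure is dominated by Lebesgue measure, and [h] agrees almost everywhere with its
    Radon-Nikodym derivative, since both have the same integrals over measurable sets. *)
Lemma integral_density nu (h : R -> R) (f : R -> \bar R) :
  measurable_fun setT h ->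
  (forall A, measurable A -> nu A = \int[leb]_(x in A) (h x)%:E)%E ->
  nu.-integrable setT f ->
  (\int[nu]_x f x = \int[leb]_x (f x * (h x)%:E))%E.
Proof.
move=> mh nuE intf.
have dom : nu `<< leb.
  apply/null_content_dominatesP => A mA A0.
  by rewrite nuE// null_set_integral//; exact/measurable_EFinP/measurable_funTS.
rewrite -(Radon_Nikodym_change_of_variables dom)//=.
apply: ae_eq_integral => //.
- by apply: emeasurable_funM => //; apply: (measurable_int nu).
- apply: emeasurable_funM => //=; first exact: (measurable_int nu).
  exact/measurable_EFinP.
- apply: ae_eqe_mul2l => /=.
  rewrite Radon_NikodymE//=.
  case: cid => /= g [g1 g2 g3].
  apply: integral_ae_eq => //=; first exact/measurable_EFinP.
  by move=> E _ mE; rewrite -g3//= nuE.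
Qed.

(** Serves both laws: each density is a constant times a continuous function on a segment, extended
    by zero. *)
Lemma moment_density nu (h g : R -> R) a b (c : R) n :
  compactly_supported nu -> measurable_fun setT h ->
  (forall A, measurable A -> nu A = \int[leb]_(x in A) (h x)%:E)%E ->
  (forall x, h x = if a <= x <= b then c * g x else 0) ->
  {within `[a, b], continuous g} ->
  fine (moment nu n) = c * (\int[leb]_(x in `[a, b]) (x ^+ n * g x))%R.
Proof.
move=> cs mh nuE hE cg; rewrite /moment.
rewrite (integral_density mh)//; last exact: integrable_expr.
rewrite -RintegralZl//; last first.
  apply: continuous_compact_integrable; first exact: segment_compact.
  have cX : {within `[a, b], continuous (fun x : R => x ^+ n)}.
    by apply: continuous_subspaceT; exact: exprn_continuous.
  by move=> x; apply: cvgM; [exact: cX|exact: cg].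
congr fine; rewrite [RHS]integral_mkcond; apply: eq_integral => x _.
rewrite patchE hE; case: ifPn => xab.
  by rewrite ifT ?inE/= ?in_itv//= -EFinM; congr EFin; ring.
by rewrite ifF ?mulr0 ?mule0//; apply/negP; rewrite inE/= in_itv/= (negbTE xab).
Qed.

Lemma is_derive_expr n (x : R) :
  is_derive x 1 (fun y : R => y ^+ n) (n%:R * x ^+ n.-1).
Proof.
by apply: DeriveDef; [exact: exprn_derivable|rewrite exp_derive scaler1].
Qed.

Lemma moment_uniform (t : R) (t0 : 0 < t) n :
  compactly_supported (uniform_prob (opp_lt0 t0)) ->
  fine (moment (uniform_prob (opp_lt0 t0)) n) = (- t) ^+ n / n.+1%:R.
Proof.
move=> cs.
have -> := @moment_density _ (uniform_pdf (- t) 0) (cst 1) (- t) 0 t^-1 n cs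
  (measurable_uniform_pdf _ _) (fun _ _ => erefl); first last.
- by apply: continuous_subspaceT => x; exact: cvg_cst.
- by move=> x; rewrite /uniform_pdf sub0r opprK mulr1.
have tneq0 : t != 0 by rewrite gt_eqF.
have dF (x : R) : is_derive x 1 (fun x : R => n.+1%:R^-1 * x ^+ n.+1) (x ^+ n).
  apply: is_derive_eq (is_deriveZ n.+1%:R^-1 (is_derive_expr n.+1 x)) _.
  by rewrite /GRing.scale/= mulKf// pnatr_eq0.
have cF : continuous (fun x : R => n.+1%:R^-1 * x ^+ n.+1).
  by move=> x; apply: cvgM; [exact: cvg_cst|exact: exprn_continuous].
rewrite /Rintegral (_ : integral _ _ _ =
    (\int[leb]_(x in `[(- t)%R, 0%R]) (x ^+ n)%:E)%E); last first.
  by apply: eq_integral => x _; rewrite mulr1.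
rewrite (@continuous_FTC2 _ _ (fun x : R => n.+1%:R^-1 * x ^+ n.+1)).
- rewrite -EFinB/= expr0n/= mulr0 sub0r exprS; field.
  by rewrite tneq0 nat1r pnatr_eq0.
- exact: opp_lt0.
- by apply: continuous_subspaceT; exact: exprn_continuous.
- split; first by move=> x _; apply: ex_derive.
  + exact/cvg_at_right_filter/cF.
  + exact/cvg_at_left_filter/cF.
- by move=> x _; rewrite derive1E; apply: derive_val.
Qed.

(* Integrate the derivative of [x^k (r^2 - x^2)^(3/2)]; at [k = 0] the factor
   [k%:R] makes the truncated [k.-1] harmless. *)
Lemma moment_semicircle_rec (r : R) (r0 : 0 < r) k :
  compactly_supported (semicircle_prob r0) ->
  (k + 3)%:R * fine (moment (semicircle_prob r0) k.+1) =
  k%:R * r ^+ 2 * fine (moment (semicircle_prob r0) k.-1).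
Proof.
move=> cs; pose S x := Num.sqrt (r ^+ 2 - x ^+ 2).
have cq : continuous (fun x : R => r ^+ 2 - x ^+ 2).
  by move=> x; apply: cvgB; [exact: cvg_cst|exact: exprn_continuous].
have cS : continuous S.
  move=> x; apply: (@continuous_comp R R R (fun x => r ^+ 2 - x ^+ 2) Num.sqrt).
    exact: cq.
  exact: sqrt_continuous.
have mE n : fine (moment (semicircle_prob r0) n) =
    2 / (pi * r ^+ 2) * (\int[leb]_(x in `[- r, r]) (x ^+ n * S x))%R.
  apply: (@moment_density _ (semicircle_pdf r)) => //.
    exact: measurable_semicircle_pdf.
  exact: continuous_subspaceT.
rewrite !mE.
set c := 2 / _.
have cXS n (e : R) : continuous (fun x : R => e * (x ^+ n * S x)).
  move=> x; apply: cvgM; first exact: cvg_cst.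
  by apply: cvgM; [exact: exprn_continuous|exact: cS].
have intZXS n (e : R) :
    leb.-integrable `[- r, r] (EFin \o (fun x : R => e * (x ^+ n * S x))).
  apply: continuous_compact_integrable; first exact: segment_compact.
  exact/continuous_subspaceT/cXS.
have intXS n : leb.-integrable `[- r, r] (EFin \o (fun x : R => x ^+ n * S x)).
  by apply: eq_integrable (intZXS n 1) => // x _ /=; rewrite mul1r.
pose F (x : R) : R := x ^+ k * ((r ^+ 2 - x ^+ 2) * S x).
pose G (x : R) : R :=
  k%:R * r ^+ 2 * (x ^+ k.-1 * S x) - (k + 3)%:R * (x ^+ k.+1 * S x).
have cF : continuous F.
  move=> x; apply: cvgM; first exact: exprn_continuous.
  by apply: cvgM; [exact: cq|exact: cS].
(* The square root is differentiable only where [r ^+ 2 - x ^+ 2] is positive; at the endpoints,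
   continuity of [F] is enough for the fundamental theorem of calculus. *)
have dF (x : R) : x \in `]- r, r[%R -> is_derive x 1 F (G x).
  rewrite in_itv/= => xr.
  have q0 : 0 < r ^+ 2 - x ^+ 2.
    have -> : r ^+ 2 - x ^+ 2 = (r - x) * (r + x) by ring.
    by apply: mulr_gt0; lra.
  have S0 : S x != 0 by rewrite gt_eqF// sqrtr_gt0.
  have dq : is_derive x 1 (fun y : R => r ^+ 2 - y ^+ 2) (0 - 2 * x ^+ 1).
    exact: is_deriveB (is_derive_cst (r ^+ 2) x 1) (is_derive_expr 2 x).
  have dS : is_derive x 1 S (- x / S x).
    have d : is_derive x 1 S
        ((2 * Num.sqrt (r ^+ 2 - x ^+ 2))^-1 * (0 - 2 * x ^+ 1)).
      exact: (@is_derive1_comp R Num.sqrt _ x _ _ (is_derive1_sqrt q0) dq).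
    by apply: is_derive_eq d _; rewrite -/(S x) sub0r expr1; field.
  have dM := is_deriveM dq dS.
  apply: is_derive_eq (is_deriveM (is_derive_expr k x) dM) _.
  rewrite /GRing.scale/= /G sub0r expr1.
  rewrite -[(_ * S) x]/((r ^+ 2 - x ^+ 2) * S x).
  have -> : (r ^+ 2 - x ^+ 2) * (- x / S x) = - x * S x.
    by rewrite -(sqr_sqrtr (ltW q0)) -/(S x); field.
  by case: (k) => [|m]; rewrite ?expr0 ?[in RHS]exprS /= natrD ?exprS; ring.
have FTC : (\int[leb]_(x in `[- r, r]) G x)%R = 0.
  rewrite /Rintegral (@continuous_FTC2 _ _ F).
  - by rewrite /F sqrrN subrr !mul0r !mulr0 subee.
  - lra.
  - apply: continuous_subspaceT => x; apply: cvgB; exact: cXS.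
  - split; first by move=> x /dF ?; apply: ex_derive.
    + exact/cvg_at_right_filter/cF.
    + exact/cvg_at_left_filter/cF.
  - by move=> x /dF ?; rewrite derive1E; apply: derive_val.
move: FTC; rewrite RintegralB//.
rewrite !RintegralZl// => /eqP; rewrite subr_eq0 => /eqP e.
by rewrite mulrCA -e; ring.
Qed.

End Analysis.

(** * Formal power series *)

Record fps (A : Type) := Fps { fcoef : nat -> A }.
Local Notation "f `[ n ]" := (fcoef f n) (at level 3, format "f `[ n ]").

HB.instance Definition _ (A : Type) := gen_eqMixin (fps A).
HB.instance Definition _ (A : Type) := gen_choiceMixin (fps A).

Lemma fpsP (A : Type) (f g : fps A) : (forall n, f`[n] = g`[n]) -> f = g.
Proof. by case: f; case: g => f g /= /funext ->. Qed.

Section FpsZmodule.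
Variable A : zmodType.
Implicit Types f g : fps A.

Definition fps0 : fps A := Fps (fun=> 0).
Definition fpsD f g := Fps (fun n => f`[n] + g`[n]).
Definition fpsN f := Fps (fun n => - f`[n]).

Fact fpsDA : associative fpsD.
Proof. by move=> *; apply: fpsP => n /=; rewrite addrA. Qed.
Fact fpsDC : commutative fpsD.
Proof. by move=> *; apply: fpsP => n /=; rewrite addrC. Qed.
Fact fps0D : left_id fps0 fpsD.
Proof. by move=> *; apply: fpsP => n /=; rewrite add0r. Qed.
Fact fpsND : left_inverse fps0 fpsN fpsD.
Proof. by move=> *; apply: fpsP => n /=; rewrite addNr. Qed.

HB.instance Definition _ := GRing.isZmodule.Build (fps A)
  fpsDA fpsDC fps0D fpsND.

Lemma fcoef0 n : (0 : fps A)`[n] = 0. Proof. by []. Qed.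
Lemma fcoefD f g n : (f + g)`[n] = f`[n] + g`[n]. Proof. by []. Qed.
Lemma fcoefN f n : (- f)`[n] = - f`[n]. Proof. by []. Qed.
Lemma fcoefB f g n : (f - g)`[n] = f`[n] - g`[n]. Proof. by []. Qed.

Lemma fcoef_sum (I : Type) (r : seq I) (P : pred I) (F : I -> fps A) n :
  (\sum_(i <- r | P i) F i)`[n] = \sum_(i <- r | P i) (F i)`[n].
Proof. by elim/big_rec2: _ => // i x y _ <-. Qed.

(* The sum of the series [g^k a_k], where [g] is the variable. *)
Definition shiftsum (a : nat -> fps A) : fps A :=
  Fps (fun n => \sum_(k < n.+1) (a k)`[n - k]).

Lemma shiftsumD (a b : nat -> fps A) :
  shiftsum a + shiftsum b = shiftsum (fun k => a k + b k).
Proof. by apply: fpsP => n /=; rewrite -big_split. Qed.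

Lemma eq_shiftsum (a b : nat -> fps A) : a =1 b -> shiftsum a = shiftsum b.
Proof. by move=> ab; apply: fpsP => n; apply: eq_bigr => k _; rewrite ab. Qed.

End FpsZmodule.

Section FpsRing.
Variable A : nzRingType.
Implicit Types f g h : fps A.

Definition fpsC (c : A) := Fps (fun n => if n == 0 then c else 0).
Definition fpsM f g := Fps (fun n => \sum_(i < n.+1) f`[i] * g`[n - i]).

Definition fps_trunc N f : {poly A} := \poly_(i < N) f`[i].

(** Coefficients below [N] see only the truncations, so associativity is inherited from
    polynomials. *)
Fact fpsM_trunc f g N n : (n < N)%N ->
  (fpsM f g)`[n] = (fps_trunc N f * fps_trunc N g)`_n.
Proof.
move=> nN; rewrite coefM; apply: eq_bigr => i _; rewrite !coef_poly.
by rewrite (leq_ltn_trans (leq_ord i) nN) (leq_ltn_trans (leq_subr i n) nN).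
Qed.

Fact fpsMA : associative fpsM.
Proof.
move=> f g h; apply: fpsP => n; rewrite !(@fpsM_trunc _ _ n.+1)//.
transitivity ((fps_trunc n.+1 f * (fps_trunc n.+1 g * fps_trunc n.+1 h))`_n).
  rewrite !coefM; apply: eq_bigr => i _; congr (_ * _).
  rewrite coef_poly (leq_ltn_trans (leq_subr i n))//.
  by rewrite (@fpsM_trunc _ _ n.+1) ?ltnS ?leq_subr.
rewrite mulrA !coefM; apply: eq_bigr => i _; congr (_ * _).
by rewrite coef_poly ltn_ord (@fpsM_trunc _ _ n.+1).
Qed.

Fact fps1M : left_id (fpsC 1) fpsM.
Proof.
move=> f; apply: fpsP => n /=; rewrite big_ord_recl/= mul1r subn0 big1 ?addr0//.
by move=> i _; rewrite mul0r.
Qed.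

Fact fpsM1 : right_id (fpsC 1) fpsM.
Proof.
move=> f; apply: fpsP => n /=; rewrite big_ord_recr/= subnn mulr1 big1 ?add0r//.
by move=> i _; rewrite subn_eq0 leqNgt ltn_ord mulr0.
Qed.

Fact fpsMDl : left_distributive fpsM +%R.
Proof.
move=> f g h; apply: fpsP => n /=; rewrite -big_split/=.
by apply: eq_bigr => i _; rewrite mulrDl.
Qed.

Fact fpsMDr : right_distributive fpsM +%R.
Proof.
move=> f g h; apply: fpsP => n /=; rewrite -big_split/=.
by apply: eq_bigr => i _; rewrite mulrDr.
Qed.

Fact fps1_neq0 : fpsC 1 != 0.
Proof. by apply/eqP => /(congr1 (fun f => f`[0])) /eqP/=; rewrite oner_eq0. Qed.

HB.instance Definition _ := GRing.Zmodule_isNzRing.Build (fps A)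
  fpsMA fps1M fpsM1 fpsMDl fpsMDr fps1_neq0.

Lemma fcoef1 n : (1 : fps A)`[n] = (n == 0)%:R.
Proof. by rewrite -[1]/(fpsC 1)/=; case: eqP. Qed.

Lemma fcoefM f g n : (f * g)`[n] = \sum_(i < n.+1) f`[i] * g`[n - i].
Proof. by []. Qed.

Lemma fcoef0M f g : (f * g)`[0] = f`[0] * g`[0].
Proof. by rewrite fcoefM big_ord1. Qed.

Lemma fcoefCM c f n : (fpsC c * f)`[n] = c * f`[n].
Proof.
rewrite fcoefM big_ord_recl/= subn0 big1 ?addr0// => i _.
by rewrite mul0r.
Qed.

Definition fpsX : fps A := Fps (fun n => (n == 1)%:R).

Lemma fcoef0XM f : (fpsX * f)`[0] = 0.
Proof. by rewrite fcoef0M/= mul0r. Qed.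

Lemma fcoefSXM f n : (fpsX * f)`[n.+1] = f`[n].
Proof.
rewrite fcoefM !big_ord_recl/= mul0r add0r mul1r subSS subn0 big1 ?addr0//.
by move=> i _; rewrite mul0r.
Qed.

Lemma fpsX_comm f : f * fpsX = fpsX * f.
Proof.
apply: fpsP => -[|n]; first by rewrite fcoef0XM fcoef0M/= mulr0.
rewrite fcoefSXM fcoefM !big_ord_recr/= subnn mulr0 addr0 subSnn mulr1.
rewrite big1 ?add0r// => i _.
have -> : (n.+1 - i == 1)%N = false by case: i => i /= ?; lia.
by rewrite mulr0.
Qed.

Lemma fpsXn_comm f k : f * fpsX ^+ k = fpsX ^+ k * f.
Proof. exact: commrX (fpsX_comm f). Qed.

Lemma fcoefXnM f k n :
  (fpsX ^+ k * f)`[n] = if (n < k)%N then 0 else f`[n - k].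
Proof.
elim: k n => [|k IH] [|n]; rewrite ?expr0 ?mul1r//.
  by rewrite exprS -mulrA fcoef0XM.
by rewrite exprS -mulrA fcoefSXM IH ltnS subSS.
Qed.

(** Any bound [N] beyond [n] will do, so one finite sum represents all coefficients up to [n] and
    the ring laws for finite sums apply. *)
Lemma fcoef_shiftsum (a : nat -> fps A) N n : (n < N)%N ->
  (shiftsum a)`[n] = (\sum_(k < N) fpsX ^+ k * a k)`[n].
Proof.
move=> nN; rewrite fcoef_sum (eq_bigr _ (fun _ _ => fcoefXnM _ _ _))/=.
rewrite -(subnK nN) addnC big_split_ord/= [X in _ + X]big1 ?addr0.
  by apply: eq_bigr => k _; rewrite ltnNge leq_ord.
by move=> k _; rewrite ltn_addr.
Qed.

Lemma shiftsumMr (a : nat -> fps A) f :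
  shiftsum a * f = shiftsum (fun k => a k * f).
Proof.
apply: fpsP => n; rewrite (@fcoef_shiftsum _ n.+1)//.
under [in RHS]eq_bigr do rewrite mulrA.
rewrite -mulr_suml !fcoefM; apply: eq_bigr => i _.
by rewrite (@fcoef_shiftsum _ n.+1).
Qed.

Lemma shiftsumMl (a : nat -> fps A) f :
  f * shiftsum a = shiftsum (fun k => f * a k).
Proof.
apply: fpsP => n; rewrite (@fcoef_shiftsum _ n.+1)//.
under [in RHS]eq_bigr do rewrite mulrA -fpsXn_comm -mulrA.
rewrite -mulr_sumr !fcoefM; apply: eq_bigr => i _.
by rewrite (@fcoef_shiftsum _ n.+1)// ltnS leq_subr.
Qed.

Lemma shiftsum_recl (a : nat -> fps A) :
  shiftsum a = a 0 + fpsX * shiftsum (fun k => a k.+1).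
Proof.
apply: fpsP => -[|n]; rewrite fcoefD ?fcoef0XM ?fcoefSXM /=.
  by rewrite big_ord1 addr0.
by rewrite big_ord_recl.
Qed.

Lemma shiftsum_geom f : (1 - fpsX * f) * shiftsum (fun k => f ^+ k) = 1.
Proof.
rewrite mulrBl mul1r -mulrA shiftsumMl [X in X - _]shiftsum_recl expr0.
rewrite (eq_shiftsum (b := fun k => f * f ^+ k)) ?addrK// => k.
by rewrite exprS.
Qed.

(* The geometric series; it is [(1 - f)^-1] when [f] has no constant term. *)
Definition fgeom f : fps A :=
  shiftsum (fun k => (Fps (fun n => f`[n.+1])) ^+ k).

Lemma fps_divX f : f`[0] = 0 -> f = fpsX * Fps (fun n => f`[n.+1]).
Proof. by move=> f0; apply: fpsP => -[|n]; rewrite ?fcoef0XM ?fcoefSXM. Qed.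

Lemma mul_fgeom f : f`[0] = 0 -> (1 - f) * fgeom f = 1.
Proof. by move=> f0; rewrite {1}(fps_divX f0) shiftsum_geom. Qed.

End FpsRing.

(** * Commutative power series and the Euler operator *)

Section FpsComRing.
Variable K : comNzRingType.
Implicit Types f g u : fps K.

Fact fpsMC : @commutative (fps K) (fps K) *%R.
Proof.
move=> f g; apply: fpsP => n; rewrite !fcoefM (reindex_inj rev_ord_inj)/=.
by apply: eq_bigr => i _; rewrite subSS subKn ?leq_ord// mulrC.
Qed.

HB.instance Definition _ := GRing.PzRing_hasCommutativeMul.Build (fps K) fpsMC.

(* The Euler operator [g d/dg]. *)
Definition euler f := Fps (fun n => n%:R * f`[n]).

Lemma fcoef_euler f n : (euler f)`[n] = n%:R * f`[n]. Proof. by []. Qed.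

Lemma eulerD f g : euler (f + g) = euler f + euler g.
Proof. by apply: fpsP => n /=; rewrite mulrDr. Qed.

Lemma eulerM f g : euler (f * g) = euler f * g + f * euler g.
Proof.
apply: fpsP => n; rewrite fcoefD !fcoefM /= -big_split mulr_sumr.
apply: eq_bigr => i _ /=.
by rewrite -{1}(subnK (leq_ord i)) natrD; ring.
Qed.

Lemma euler1 : euler 1 = 0.
Proof. by apply: fpsP => -[|n] /=; rewrite ?fcoef1 ?mul0r ?mulr0. Qed.

Lemma euler_inv u f : u * f = 1 -> euler u = - (u * u * euler f).
Proof.
move=> uf; have := congr1 (fun h => u * euler h) uf.
rewrite /= euler1 mulr0 eulerM => e0.
(* The bracket is [euler (u * f)], which is [0], and so is the factor [1 - u * f]. *)
have -> : euler u = u * (euler u * f + u * euler f) - u * u * euler f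
                    + euler u * (1 - u * f) by ring.
by rewrite e0 uf subrr mulr0 addr0 sub0r.
Qed.

Lemma eulerXn f n : euler (f ^+ n.+1) = n.+1%:R * f ^+ n * euler f.
Proof.
elim: n => [|n IH]; first by rewrite expr1 expr0 !mul1r.
by rewrite exprS eulerM IH -(natr1 n.+1) !exprS; ring.
Qed.

Lemma natrMfcoef f k n : (k%:R * f)`[n] = k%:R * f`[n].
Proof.
elim: k => [|k IH]; first by rewrite !mul0r.
by rewrite -!natr1 !mulrDl fcoefD IH !mul1r.
Qed.

Lemma fpsCM (a b : K) : fpsC a * fpsC b = fpsC (a * b).
Proof. by apply: fpsP => n; rewrite fcoefCM/=; case: eqP; rewrite ?mulr0. Qed.

Lemma natrMfpsC n (a : K) : n%:R * fpsC a = fpsC (n%:R * a).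
Proof.
by apply: fpsP => m; rewrite natrMfcoef/=; case: eqP; rewrite ?mulr0.
Qed.

Lemma euler_fpsX : euler (fpsX K) = fpsX K.
Proof. by apply: fpsP => -[|[|n]] /=; rewrite ?mulr0 ?mulr1. Qed.

Lemma euler_fpsC c : euler (fpsC c) = 0.
Proof. by apply: fpsP => -[|n] /=; rewrite ?mul0r ?mulr0. Qed.

Lemma euler_shiftsum (a : nat -> fps K) :
  euler (shiftsum a) = shiftsum (fun k => k%:R * a k + euler (a k)).
Proof.
apply: fpsP => n; rewrite [LHS]mulr_sumr; apply: eq_bigr => k _.
by rewrite fcoefD natrMfcoef -{1}(subnKC (leq_ord k)) natrD mulrDl.
Qed.

(* If [T = sum_k c_k g^k u^(k+1)] and [w = g u], then [g T = sum_k c_k w^(k+1)]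
   and this is the chain rule for [g d/dg (g T)], divided by [g]. *)
Lemma euler_chain (c : nat -> K) u :
  let T := shiftsum (fun k => fpsC (c k) * u ^+ k.+1) in
  T + euler T =
  shiftsum (fun k => fpsC (c k) * (k.+1%:R * u ^+ k)) * (u + euler u).
Proof.
rewrite /= euler_shiftsum shiftsumD shiftsumMr; apply: eq_shiftsum => k.
by rewrite eulerM euler_fpsC eulerXn exprS -natr1; ring.
Qed.

End FpsComRing.

(** * Recurrence and boundary values of the signed Stirling numbers *)

Lemma coef_rising_gt n k : (n < k)%N ->
  (\prod_(i < n) ('X + i%:R%:P) : {poly int})`_k = 0.
Proof.
move=> nk; rewrite nth_default// (leq_trans (size_poly_prod_leq _ _))//.
rewrite (eq_bigr (fun=> 2%N)) => [|i _]; last by rewrite size_XaddC.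
by rewrite sum_nat_const card_ord; lia.
Qed.

Lemma stirling1_gt n k : (n < k)%N -> stirling1 n k = 0.
Proof. by move=> nk; rewrite /stirling1 coef_rising_gt ?mulr0. Qed.

Lemma stirling1S n k :
  stirling1 n.+1 k.+1 = stirling1 n k - n%:R * stirling1 n k.+1.
Proof.
rewrite /stirling1 big_ord_recr/= mulrDr coefD coefMX coefMC/= subSS.
(* For [n <= k] the truncated exponents [n - k] and [n - k.+1] coincide, which is harmless because
   the coefficient of index [k.+1] is zero. *)
case: (ltnP k n) => kn; last by rewrite (@coef_rising_gt n k.+1)//; ring.
by rewrite -[(n - k)%N]prednK ?subn_gt0// -subnS !exprS; ring.
Qed.

Lemma stirling1S0 n : stirling1 n.+1 0 = 0.
Proof. by rewrite /stirling1 big_ord_recl/= addr0 coefXM mulr0. Qed.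

Lemma stirling1nn n : stirling1 n n = 1.
Proof.
elim: n => [|n IH]; first by rewrite /stirling1 big_ord0 coef1 mulr1.
by rewrite stirling1S IH stirling1_gt// mulr0 subr0.
Qed.

(** * Generating series *)

Section Series.
Variable K : numFieldType.
Implicit Types (f u psi : fps K) (c : nat -> K) (t : K).

(* [g momsum c u] is [sum_k c_k w^(k+1)] for [w = g u]. *)
Definition momsum c u := shiftsum (fun k => fpsC (c k) * u ^+ k.+1).

(* Lagrange inversion for [w = g / psi]: the hypothesis reads
   [sum_k c_k w^(k+1) = g]. *)
Lemma lagrange_inversion c u psi : u * psi = 1 -> psi`[0] = 1 ->
  momsum c u = 1 -> forall n, n.+1%:R * c n = (psi ^+ n.+1)`[n].
Proof.
move=> upsi psi0 Tu n.
(* Since the sum is [1], the chain rule writes [1] as a series in the [c k]; multiplying by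
   [psi ^+ n.+1] expresses the wanted coefficient through them. *)
have := euler_chain c u; rewrite /= -/(momsum c u) Tu euler1 addr0.
move=> /(congr1 ( *%R ^~ (psi ^+ n.+1))); rewrite mul1r => ->.
have eu : u + euler u = u - u * u * euler psi by rewrite (euler_inv upsi).
have uk (k : nat) : (k <= n)%N ->
    u ^+ k * (u + euler u) * psi ^+ n.+1 =
    psi ^+ (n - k) - u * psi ^+ (n - k) * euler psi.
  move=> kn; rewrite eu -{1}(subnKC kn) -addnS exprD exprS.
  transitivity ((u * psi) ^+ k * (u * psi) *
      (psi ^+ (n - k) - u * psi ^+ (n - k) * euler psi)).
    by rewrite exprMn; ring.
  by rewrite upsi expr1n !mul1r.
rewrite !shiftsumMr /=.
have E (k : 'I_n.+1) :
    (fpsC (c k) * (k.+1%:R * u ^+ k) * (u + euler u) * psi ^+ n.+1)`[n - k]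
    = if (k : nat) == n then n.+1%:R * c n else 0.
  have -> : fpsC (c k) * (k.+1%:R * u ^+ k) * (u + euler u) * psi ^+ n.+1 =
    fpsC (c k) * (k.+1%:R * (u ^+ k * (u + euler u) * psi ^+ n.+1)) by ring.
  rewrite uk ?leq_ord// fcoefCM natrMfcoef.
  case: eqP => [->|/eqP kn].
    rewrite subnn expr0 mulr1 fcoefB fcoef1 fcoef0M/= mul0r mulr0 subr0.
    by rewrite mulr1 mulrC.
  (* Terms with [k < n] vanish, as residues of derivatives do: applied to [psi ^+ m.+1], the Euler
     operator shows that [psi ^+ m.+1] and [psi ^+ m * euler psi] have the same coefficient of index
     [m.+1]. *)
  have : (k < n)%N by rewrite ltn_neqAle kn leq_ord.
  rewrite -subn_gt0; case: (n - k)%N => // m _.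
  have := congr1 (fun f => f`[m.+1]) (eulerXn psi m).
  rewrite -mulrA natrMfcoef [LHS]/=.
  move=> /(mulfI _) e; rewrite fcoefB {}e ?pnatr_eq0// -fcoefB exprS.
  have -> : psi ^+ m * euler psi - u * (psi * psi ^+ m) * euler psi =
     (1 - u * psi) * (psi ^+ m * euler psi) by ring.
  by rewrite upsi subrr mul0r fcoef0 !mulr0.
rewrite (eq_bigr _ (fun k _ => E k)) (bigD1 ord_max)//= eqxx big1 ?addr0//.
by move=> k kn; case: eqP => // kn'; case/eqP: kn; apply: val_inj.
Qed.

Variable t : K.

(* The series of [(e^(t g) - 1) / (t g)]. *)
Definition fexp1 : fps K := Fps (fun n => t ^+ n / (n.+1)`!%:R).

(** With [E = fexp1], the left side is the derivative of [g E = (e^(t g) - 1) / t], that is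
    [e^(t g) = 1 + t g E]. *)
Lemma euler_fexp1 : fexp1 + euler fexp1 = 1 + fpsC t * (fpsX K * fexp1).
Proof.
apply: fpsP => -[|n].
  rewrite !fcoefD fcoefCM fcoef0XM fcoef1 /= mul0r mulr0 !addr0.
  by rewrite expr0 (factS 0) divr1.
rewrite !fcoefD fcoefCM fcoefSXM fcoef1 /=.
rewrite factS natrM exprS add0r -natr1.
by field; rewrite nat1r natr1 !pnatr_eq0 -lt0n fact_gt0.
Qed.

(* The variable is [log (1 + t h) / t] at [h = g fexp1 = (e^(t g) - 1) / t]. *)
Lemma momsum_unif : momsum (fun n => (- t) ^+ n / n.+1%:R) fexp1 = 1.
Proof.
have := euler_chain (fun n => (- t) ^+ n / n.+1%:R) fexp1.
rewrite /= -/(momsum _ _) euler_fexp1.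
(* The factor [k.+1] cancels the denominator, leaving a geometric series that is inverse to the
   other factor [1 + t g E]. *)
rewrite (eq_shiftsum (b := fun k => (fpsC (- t) * fexp1) ^+ k)); last first.
  move=> k; rewrite exprMn mulrA; congr (_ * _).
  elim: k => [|k IH].
    by apply: fpsP => n; rewrite !expr0 mulr1 fcoef1 /= divr1; case: eqP.
  rewrite [RHS]exprS -IH [LHS]mulrC; apply: fpsP => n.
  rewrite fcoefCM natrMfcoef.
  rewrite [X in _ = _ * X`[_]]mulrC natrMfcoef /=.
  case: eqP => _; last by rewrite !mulr0.
  by rewrite exprS; field; rewrite -natrD nat1r !pnatr_eq0.
rewrite mulrC.
have -> : 1 + fpsC t * (fpsX K * fexp1) = 1 - fpsX K * (fpsC (- t) * fexp1).
  apply: fpsP => n; rewrite [fpsX K * (fpsC (- t) * _)]mulrCA.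
  by rewrite !fcoefD fcoefN !fcoefCM; ring.
(* Coefficientwise, [T + euler T = 1] reads [(n + 1) T_n = 0] for [n > 0]. *)
rewrite shiftsum_geom => T1; apply: fpsP => n.
move/(congr1 (fun f => f`[n])): T1; rewrite fcoefD fcoef1.
case: n => [|n] /=; first by rewrite mul0r addr0.
rewrite -{1}[X in X + _]mul1r -mulrDl nat1r => /eqP.
by rewrite mulf_eq0 pnatr_eq0 /= => /eqP.
Qed.

(** The recurrence of the semicircle moments becomes a first-order linear differential equation for
    [momsum c u], whose only power series solution is [1]. *)
Lemma momsum_semicircle c u :
  u * (1 + fpsC t * fpsX K ^+ 2) = 1 -> c 0 = 1 -> c 1 = 0 ->
  (forall n, (n + 4)%:R * c n.+2 = 4 * t * n.+1%:R * c n) -> momsum c u = 1.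
Proof.
set D := 1 + _ => uD c0 c1 crec.
set T := momsum c u; set X := fpsX K; set C := fpsC t.
pose P := shiftsum (fun k => fpsC (c k) * (k.+1%:R * u ^+ k)).
pose N := shiftsum (fun k => fpsC (c k) * u ^+ k).
have NT : N = D * T.
  rewrite /T /momsum shiftsumMl; apply: eq_shiftsum => k.
  have -> : D * (fpsC (c k) * u ^+ k.+1) = fpsC (c k) * ((u * D) * u ^+ k).
    by rewrite exprS; ring.
  by rewrite uD mul1r.
have eX : euler (X ^+ 2) = X ^+ 2 *+ 2 by rewrite eulerXn euler_fpsX -/X; ring.
have eu : u + euler u = u * u * (1 - C * X ^+ 2).
  rewrite (euler_inv uD) eulerD euler1 eulerM euler_fpsC -/C -/X eX.
  have {1}-> : u = u * (u * D) by rewrite uD mulr1.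
  by rewrite /D -/C -/X; ring.
have chain : T + euler T = P * (u * u * (1 - C * X ^+ 2)).
  by rewrite -eu euler_chain.
(* With [w = g u], the left side is the sum of [(k + 2) c_k w^k]. The terms [k = 0, 1] give [2], and
   the recurrence turns the others into [4 t w^2 P]. *)
have PN : P + N = 2 + X ^+ 2 * (4 * C * u ^+ 2 * P).
  rewrite shiftsumD shiftsum_recl [X in _ + _ * X]shiftsum_recl.
  have -> : 4 * C * u ^+ 2 * P =
      shiftsum (fun k => fpsC (c k.+2) * (k.+3%:R * u ^+ k.+2) +
                         fpsC (c k.+2) * u ^+ k.+2).
    rewrite /P shiftsumMl; apply: eq_shiftsum => k.
    have -> : fpsC (c k.+2) * (k.+3%:R * u ^+ k.+2) +
              fpsC (c k.+2) * u ^+ k.+2 =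
      fpsC (c k.+2) * (k + 4)%:R * u ^+ k.+2.
      by rewrite addn4 -(natr1 k.+3); ring.
    have -> : 4 * C * u ^+ 2 * (fpsC (c k) * (k.+1%:R * u ^+ k)) =
      4 * C * fpsC (c k) * k.+1%:R * u ^+ k.+2 by rewrite !exprS; ring.
    congr (_ * _); rewrite [RHS]mulrC (natrMfpsC (k + 4)) crec.
    rewrite -mulrA [_ * k.+1%:R]mulrC (natrMfpsC k.+1) -mulrA.
    rewrite fpsCM (natrMfpsC 4).
    by congr fpsC; ring.
  rewrite c0 c1 !expr0 -/X -[fpsC 1]/(1 : fps K).
  have -> : fpsC 0 = 0 :> fps K by apply: fpsP => -[].
  ring.
(* As [(1 - t g^2)^2 = D^2 - 4 t g^2] and [u D = 1], the relation [PN] eliminates [P]. *)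
have ode : (T + euler T) * (1 - C * X ^+ 2) + D * T = 2.
  rewrite -NT chain.
  have -> : P * (u * u * (1 - C * X ^+ 2)) * (1 - C * X ^+ 2) + N =
     (P + N) + P * (u * u * (1 - C * X ^+ 2) * (1 - C * X ^+ 2) - 1) by ring.
  rewrite PN.
  have -> : u * u * (1 - C * X ^+ 2) * (1 - C * X ^+ 2) - 1 =
    (u * D) * (u * D) - 1 - 4 * C * X ^+ 2 * (u * u).
    by rewrite /D -/C -/X; ring.
  rewrite uD; ring.
pose Z := T - 1.
have TE : T = 1 + Z by rewrite addrC subrK.
have {}ode : Z + Z + euler Z = X * (X * (C * euler Z)).
  move: ode; rewrite TE eulerD euler1 /D -/C -/X => ode.
  apply/eqP; rewrite -subr_eq0; apply/eqP.
  by move/eqP: ode; rewrite -subr_eq0 => /eqP <-; ring.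
rewrite TE (_ : Z = 0) ?addr0//; apply: fpsP => n.
have hn (m : nat) : (m + 2)%:R * Z`[m] = 0 -> Z`[m] = 0.
  by move/eqP; rewrite mulf_eq0 pnatr_eq0 addn2 => /eqP.
(* The equation gives [(n + 2) Z_n = t (n - 2) Z_(n-2)] for [n >= 2], and [(n + 2) Z_n = 0] for
   [n < 2]. *)
elim/ltn_ind: n => n IH.
apply: hn; have := congr1 (fun f => f`[n]) ode.
rewrite !fcoefD [(euler Z)`[n]]/=.
have -> : (n + 2)%:R * Z`[n] = Z`[n] + Z`[n] + n%:R * Z`[n].
  by rewrite natrD; ring.
move=> ->.
case: n IH => [|[|n]] IH; first by rewrite fcoef0XM.
  by rewrite fcoefSXM fcoef0XM.
by rewrite !fcoefSXM fcoefCM fcoef_euler IH ?fcoef0 ?mulr0// ltnW.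
Qed.

(* Norlund's formula: [b = t g / (e^(t g) - 1)] satisfies
   [g b' = b - b^2 - t g b], and the resulting recurrence for the coefficients
   of its powers is the one of the Stirling numbers. *)
Lemma fcoef_norlund b : b * fexp1 = 1 -> forall k m, (m <= k)%N ->
  (stirling1 k.+1 (k.+1 - m))%:~R * t ^+ m =
  k`!%:R / (k - m)`!%:R * (b ^+ k.+1)`[m].
Proof.
move=> bE.
have b0 : b`[0] = 1.
  have := congr1 (fun f => f`[0]) bE.
  by rewrite fcoef0M fcoef1/= expr0 (factS 0) divr1 mulr1.
have eb : euler b = b - b * b - fpsC t * (fpsX K * b).
  have eE : euler fexp1 = 1 + fpsC t * (fpsX K * fexp1) - fexp1.
    by rewrite -euler_fexp1 addrC addKr.
  rewrite (euler_inv bE) eE.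
  have -> : - (b * b * (1 + fpsC t * (fpsX K * fexp1) - fexp1)) =
      b * (b * fexp1) - b * b - (b * fexp1) * (fpsC t * (fpsX K * b)) by ring.
  by rewrite bE mulr1 mul1r.
(* Compares two expressions for [euler (b ^+ k.+1)]: coefficient by coefficient, and through
   [eb]. *)
have brec k m : k.+1%:R * (b ^+ k.+2)`[m] =
    k.+1%:R * (b ^+ k.+1)`[m] - m%:R * (b ^+ k.+1)`[m] -
    k.+1%:R * (t * (fpsX K * b ^+ k.+1)`[m]).
  have : (euler (b ^+ k.+1))`[m] = (k.+1%:R * b ^+ k * euler b)`[m].
    by rewrite eulerXn.
  rewrite fcoef_euler eb.
  have -> : k.+1%:R * b ^+ k * (b - b * b - fpsC t * (fpsX K * b)) =
    k.+1%:R * (b ^+ k.+1 - b ^+ k.+2 - fpsC t * (fpsX K * b ^+ k.+1)).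
    by rewrite !exprS; ring.
  rewrite natrMfcoef !fcoefB fcoefCM => ->; ring.
have bn0 k : (b ^+ k)`[0] = 1.
  by elim: k => [|k IH]; rewrite ?expr0 ?fcoef1// exprS fcoef0M b0 IH mulr1.
have f_neq0 n : n`!%:R != 0 :> K by rewrite pnatr_eq0 -lt0n fact_gt0.
elim=> [|k IH] [|m] mk //; rewrite ?subn0 ?stirling1nn ?bn0 ?expr0.
- by rewrite fact0 divr1 !mulr1.
- by rewrite divff ?mulr1.
rewrite subSS subSn// stirling1S.
have e1 := IH m mk.
rewrite subSn// in e1.
have {}e1 : k.+1%:R * (stirling1 k.+1 (k - m).+1)%:~R * t ^+ m.+1 =
    k.+1%:R * t * (k`!%:R / (k - m)`!%:R * (b ^+ k.+1)`[m]).
  by rewrite -e1 exprS; ring.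
(* For [m = k] the induction hypothesis does not reach [m.+1], but both sides are zero. *)
have e2 : (stirling1 k.+1 (k - m))%:~R * t ^+ m.+1 =
    k`!%:R / (k - m)`!%:R * (k - m)%:R * (b ^+ k.+1)`[m.+1].
  move: mk; rewrite ltnS leq_eqVlt => /orP[/eqP->|mk].
    by rewrite subnn stirling1S0 mul0r mulr0 mul0r.
  have := IH _ mk; rewrite subSS => ->.
  rewrite -(subnSK mk) factS natrM; field.
  by rewrite nat1r f_neq0 pnatr_eq0.
have intrBM (x y : int) n : (x - n%:R * y)%:~R = x%:~R - n%:R * y%:~R :> K.
  by rewrite rmorphB rmorphM/= rmorph_nat.
rewrite intrBM mulrBl e1 e2 subSS factS natrM.
have := brec k m.+1; rewrite fcoefSXM => e3.
have -> : k.+1%:R * k`!%:R / (k - m)`!%:R * (b ^+ k.+2)`[m.+1] =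
  k`!%:R / (k - m)`!%:R * (k.+1%:R * (b ^+ k.+2)`[m.+1]) by field.
by rewrite e3 natrB//; field.
Qed.

(** In the binomial expansion, the term in [b^(j+1)] carries [g^(2 (n - j))], so it needs the
    coefficient of [b^(j+1)] of index [2 j - n]; Norlund's formula with [k = j] and [m = 2 j - n]
    supplies it. *)
Lemma fcoef_lagrange_stirling b n : b * fexp1 = 1 ->
  ((b + fpsC t * fpsX K ^+ 2) ^+ n.+1)`[n] =
  n.+1%:R * (n`!%:R * \sum_(uphalf n <= j < n.+1)
       t ^+ j / (j`! * (1 + j)`!)%:R * (stirling1 (1 + j) (n + 1 - j))%:~R).
Proof.
move=> bE; have f_neq0 k : k`!%:R != 0 :> K by rewrite pnatr_eq0 -lt0n fact_gt0.
rewrite addrC exprDn fcoef_sum.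
pose F k : K := (t ^+ (n.+1 - k) *
  (fpsX K ^+ (2 * (n.+1 - k)) * b ^+ k)`[n]) *+ 'C(n.+1, k).
rewrite (eq_bigr (fun k : 'I_n.+2 => F k)); last first.
  move=> k _; rewrite /F -[in LHS]mulr_natl natrMfcoef mulr_natl.
  rewrite exprMn -exprM -mulrA; congr (_ *+ _).
  have -> : fpsC t ^+ (n.+1 - k) = fpsC (t ^+ (n.+1 - k)).
    elim: (_ - _)%N => [|j IH]; first by rewrite !expr0; apply: fpsP => -[].
    by rewrite !exprS IH fpsCM.
  by rewrite fcoefCM.
rewrite big_ord_recl {1}/F fcoefXnM ifT; last by rewrite subn0; lia.
rewrite mulr0 mul0rn add0r.
transitivity (\sum_(0 <= j < n.+1) F j.+1); first by rewrite big_mkord.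
have hn : (uphalf n <= n.+1)%N by rewrite uphalf_half; lia.
have -> : \sum_(0 <= j < n.+1) F j.+1 =
    \sum_(0 <= j < uphalf n) F j.+1 + \sum_(uphalf n <= j < n.+1) F j.+1.
  by rewrite -big_cat_nat.
(* For [j] below [uphalf n], the exponent [2 (n - j)] of [g] exceeds [n]. *)
rewrite [X in X + _]big_nat [X in X + _]big1 => [|j /andP[_ jn]]; last first.
  rewrite /F fcoefXnM ifT ?mulr0 ?mul0rn//.
  by move: jn; rewrite uphalf_half; lia.
rewrite add0r !mulr_sumr; apply: eq_big_nat => j /andP[nj jn].
have {}nj : (n <= 2 * j)%N by move: nj; rewrite uphalf_half; lia.
have mj : (2 * j - n <= j)%N by lia.
have := fcoef_norlund bE mj.
have -> : (j.+1 - (2 * j - n) = n + 1 - j)%N by lia.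
have -> : (j - (2 * j - n) = n - j)%N by lia.
rewrite /F fcoefXnM subSS ifF; last by lia.
have -> : (n - 2 * (n - j) = 2 * j - n)%N by lia.
set c := (b ^+ j.+1)`[_]; rewrite add1n; set s := (stirling1 _ _)%:~R => e.
have -> : c = (n - j)`!%:R / j`!%:R * (s * t ^+ (2 * j - n)).
  by rewrite e; field; rewrite !f_neq0.
have ebin : (n.+1)`!%:R = 'C(n.+1, j.+1)%:R * ((j.+1)`!%:R * (n - j)`!%:R) :> K.
  by rewrite -!natrM -(bin_fact jn) subSS.
rewrite -mulr_natl.
have -> : 'C(n.+1, j.+1)%:R =
    n.+1%:R * n`!%:R / ((j.+1)`!%:R * (n - j)`!%:R) :> K.
  by rewrite -natrM -factS ebin; field; rewrite !f_neq0.
have -> : t ^+ j = t ^+ (n - j) * t ^+ (2 * j - n).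
  by rewrite -exprD; congr (_ ^+ _); lia.
by field; rewrite !f_neq0.
Qed.

End Series.

(** * Resolvent of a free sum *)

Section Resolvent.
Variables (K : numFieldType) (A : algType K).
Implicit Types (f u psi : fps K) (a Z : A).

(* [f (x) a] in the identification of [A[[g]]] with [K[[g]] (x) A]. *)
Definition fscale f a : fps A := Fps (fun n => f`[n] *: a).

Lemma fcoef_fscale f a n : (fscale f a)`[n] = f`[n] *: a. Proof. by []. Qed.

Lemma fscaleM f f' a a' : fscale f a * fscale f' a' = fscale (f * f') (a * a').
Proof.
apply: fpsP => n; rewrite fcoefM [RHS]scaler_suml; apply: eq_bigr => i _.
by rewrite /= -scalerAl -scalerAr scalerA.
Qed.

Lemma fscale1 : fscale 1 1 = 1.
Proof. by apply: fpsP => n; rewrite fcoef_fscale !fcoef1 scaler_nat. Qed.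

Lemma fscaleDl f f' a : fscale (f + f') a = fscale f a + fscale f' a.
Proof. by apply: fpsP => n /=; rewrite scalerDl. Qed.

Lemma fscaleDr f a a' : fscale f (a + a') = fscale f a + fscale f a'.
Proof. by apply: fpsP => n /=; rewrite scalerDr. Qed.

Lemma fscaleX : fscale (fpsX K) 1 = fpsX A.
Proof. by apply: fpsP => n /=; rewrite scaler_nat. Qed.

(* The inverse of [u^-1 - g Z]. *)
Definition resolvent u Z : fps A :=
  shiftsum (fun k => fscale (u ^+ k.+1) (Z ^+ k)).

Lemma resolventM u psi Z : u * psi = 1 ->
  resolvent u Z * (fscale psi 1 - fscale (fpsX K) Z) = 1.
Proof.
move=> upsi; rewrite mulrBr !shiftsumMr.
rewrite (eq_shiftsum (b := fun k => fscale (u ^+ k) (Z ^+ k))); last first.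
  by move=> k; rewrite fscaleM mulr1 exprS mulrAC upsi mul1r.
rewrite (eq_shiftsum
  (a := fun k => fscale (u ^+ k.+1) (Z ^+ k) * fscale (fpsX K) Z)
  (b := fun k => fpsX A * fscale (u ^+ k.+1) (Z ^+ k.+1))); last first.
  by move=> k; rewrite -fscaleX !fscaleM mul1r -exprSr mulrC.
by rewrite -shiftsumMl [X in X - _]shiftsum_recl !expr0 fscale1 addrK.
Qed.

(** [Z] commutes with its own powers and the scalars are central, so the products on both sides
    agree term by term. *)
Lemma Mresolvent u psi Z : u * psi = 1 ->
  (fscale psi 1 - fscale (fpsX K) Z) * resolvent u Z = 1.
Proof.
move=> upsi; rewrite -[RHS](resolventM Z upsi).
rewrite /resolvent shiftsumMl shiftsumMr; apply: eq_shiftsum => k.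
rewrite mulrBl mulrBr !fscaleM mul1r mulr1 [psi * _]mulrC [fpsX K * _]mulrC.
by rewrite -exprS -exprSr.
Qed.

Variable phi : {linear A -> K^o}.

Definition fpsmap (f : fps A) : fps K := Fps (fun n => phi (f`[n])).

Lemma fpsmap_resolvent u Z :
  fpsmap (resolvent u Z) = momsum (fun k => phi (Z ^+ k)) u.
Proof.
apply: fpsP => n; rewrite [LHS]raddf_sum; apply: eq_bigr => k _.
by rewrite fcoefCM mulrC -linearZ.
Qed.

End Resolvent.

(** * Freeness and alternating products of centered series *)

Section FreeSum.
Context {R : realType} {A : starProbSpace R}.
Local Notation C := (R[i]).
Implicit Types (x y z : fps A) (X Y : A).

Lemma resolvent_gen_alg (u : fps C) X n : gen_alg X (resolvent u X)`[n].
Proof.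
exists (\sum_(k < n.+1) (u ^+ k.+1)`[n - k] *: 'X^k) => //.
rewrite linear_sum /=; apply: eq_bigr => k _.
by rewrite linearZ/= rmorphXn/= horner_algX mulr_algl.
Qed.

Lemma gen_algB_nat X a n : gen_alg X a -> gen_alg X (a - n%:R).
Proof.
by move=> [p _ <-]; exists (p - n%:R) => //; rewrite rmorphB/= rmorph_nat.
Qed.

Section Alternating.
Variables (B : bool -> set A) (z : bool -> fps A).
Hypothesis freeB : free_family B.
Hypothesis zB : forall b n, B b (z b)`[n].
Hypothesis z0 : forall b n, state A (z b)`[n] = 0.

(* The alternating product of [l] factors whose last one is [z b]. *)
Fixpoint altprod b l : fps A :=
  if l is l'.+1 then altprod (~~ b) l' * z b else 1.

(** Freeness speaks of lists of elements, [altprod] of products of series. The list [s] holds the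
    coefficients already chosen on the right, and each induction step moves one more factor into it.
    In [(b, 0)] only the index [b] matters: the head of [s] must differ from it. *)
Lemma state_altprod_cat b l n (s : seq (bool * A)) :
  path (fun u v => u.1 != v.1) (b, 0) s ->
  (forall u, u \in s -> B u.1 u.2 /\ state A u.2 = 0) -> (0 < l + size s)%N ->
  state A ((altprod b l)`[n] * \prod_(u <- s) u.2) = 0.
Proof.
elim: l b n s => [|l IH] b n s bs sB ls.
  rewrite [altprod _ _]/= fcoef1; case: eqP => _; last by rewrite mul0r linear0.
  rewrite mul1r; apply: freeB => //; first by case: s ls {bs sB}.
  by apply: path_sorted bs.
rewrite [altprod _ _]/= fcoefM mulr_suml linear_sum big1// => i _.
have := IH (~~ b) i ((b, (z b)`[n - i]) :: s).
rewrite big_cons mulrA; apply => //; last by rewrite addnS.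
  by case: b bs {IH}; case: s sB ls.
move=> v; rewrite inE => /orP[/eqP->|]; last exact: sB.
by split; [exact: zB|exact: z0].
Qed.

Lemma state_altprod b l n : state A (altprod b l.+1)`[n] = 0.
Proof.
have := @state_altprod_cat b l.+1 n [::]; rewrite big_nil mulr1; exact.
Qed.

Lemma altprod_exp k : altprod false k.*2 = (z true * z false) ^+ k.
Proof. by elim: k => [|k IH]//=; rewrite IH exprSr mulrA. Qed.

Lemma altprod_Mexp k :
  altprod false k.*2.+1 = z false * (z true * z false) ^+ k.
Proof.
elim: k => [|k IH]; first by rewrite /= mul1r expr0 mulr1.
rewrite doubleS -[LHS]/(altprod false k.*2.+1 * z true * z false) IH.
by rewrite exprSr !mulrA.
Qed.

(** Expanding gives, for [f = z true * z false], the products [f^k], [z false * f^k], [f^k * z true]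
    and [z false * f^k * z true]. All alternate, so only the empty one has a nonzero state. *)
Lemma state_fgeom_alt n : (z true * z false)`[0] = 0 ->
  state A ((1 + z false) * fgeom (z true * z false) * (1 + z true))`[n]
  = (n == 0)%:R.
Proof.
set f := _ * _ => f0.
have E : ((1 + z false) * fgeom f * (1 + z true))`[n] =
    (\sum_(k < n.+1) (f ^+ k + z false * f ^+ k +
                       (f ^+ k * z true + z false * f ^+ k * z true)))`[n].
  rewrite shiftsumMl shiftsumMr (@fcoef_shiftsum _ _ n.+1)//.
  congr (_`[n]); apply: eq_bigr => k _; set s := Fps _.
  (* [fgeom] is built from [s], the quotient of [f] by the variable; as the variable is central, its
     powers recombine with those of [s]. *)
  have fE : f ^+ k = fpsX A ^+ k * s ^+ k.
    by rewrite {1}(fps_divX f0) exprMn_comm//; apply/commr_sym/fpsX_comm.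
  transitivity ((1 + z false) * f ^+ k * (1 + z true)).
    by rewrite fE [in RHS]mulrA fpsXn_comm !mulrA.
  by rewrite mulrDl mul1r mulrDr mulr1 mulrDl.
have F k : state A (f ^+ k + z false * f ^+ k +
    (f ^+ k * z true + z false * f ^+ k * z true))`[n] = state A (f ^+ k)`[n].
  rewrite -altprod_Mexp -altprod_exp !fcoefD !linearD state_altprod addr0.
  rewrite -[altprod false k.*2 * z true]/(altprod true k.*2.+1).
  rewrite -[altprod false k.*2.+1 * z true]/(altprod true k.*2.+2).
  by rewrite !state_altprod !addr0.
rewrite E fcoef_sum linear_sum (eq_bigr _ (fun _ _ => F _)) big_ord_recl big1.
  rewrite expr0 fcoef1 addr0; case: eqP => _; first by rewrite state1.
  by rewrite linear0.
by move=> i _; rewrite -altprod_exp lift0 doubleS state_altprod.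
Qed.

End Alternating.

Lemma free_resolvent X Y (psi1 psi2 u1 u2 u : fps C) :
  freely_independent X Y ->
  u1 * psi1 = 1 -> u2 * psi2 = 1 -> u * (psi1 + psi2 - 1) = 1 ->
  u1`[0] = 1 ->
  momsum (fun k => state A (X ^+ k)) u1 = 1 ->
  momsum (fun k => state A (Y ^+ k)) u2 = 1 ->
  momsum (fun k => state A ((X + Y) ^+ k)) u = 1.
Proof.
move=> XY u1P u2P uP u10; rewrite -!fpsmap_resolvent => mX mY.
set U := fscale psi1 1 - fscale (fpsX C) X.
set V := fscale psi2 1 - fscale (fpsX C) Y.
set U' := resolvent u1 X; set V' := resolvent u2 Y.
set M := resolvent u (X + Y).
have UU' : U * U' = 1 by apply: Mresolvent.
have VV' : V * V' = 1 by apply: Mresolvent.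
have V'V : V' * V = 1 by apply: resolventM.
have MS : M * (U + V - 1) = 1.
  rewrite -[RHS](resolventM (X + Y) uP); congr (_ * _).
  rewrite fscaleDr -[psi1 + psi2 - 1]addrA !fscaleDl.
  have -> : fscale (-1) 1 = -1 :> fps A.
    apply: fpsP => n; rewrite fcoef_fscale !fcoefN scaleNr !fcoef1.
    by rewrite scaler_nat.
  by rewrite /U /V addrACA -opprD [LHS]addrAC addrA.
clearbody U V.
pose x := U' - 1; pose y := V' - 1.
(* [U'] has constant term [1], so [x] has none, and [fgeom (x * y)] is a right inverse of
   [1 - x * y]. *)
have x0 : (x * y)`[0] = 0.
  rewrite fcoef0M fcoefB fcoef1 /x /U' /resolvent.
  have -> : (resolvent u1 X)`[0] = 1.
    by rewrite /= big_ord1 expr1 expr0 u10 scale1r.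
  by rewrite subrr mul0r.
pose Q := fgeom (x * y).
have fac : U + V - 1 = U * (1 - x * y) * V.
  have -> : 1 - x * y = U' + V' - U' * V'.
    rewrite /x mulrBl mul1r /y mulrBr mulr1 !opprB addrA [1 + _]addrC subrK.
    by rewrite addrA [V' + U']addrC.
  rewrite mulrBr mulrDr mulrBl mulrDl UU' mul1r -mulrA V'V mulr1.
  by rewrite !mulrA UU' mul1r V'V [V + U]addrC.
(* [M] is a left inverse of [U + V - 1] and [V' * Q * U'] is a right inverse, so they coincide. *)
have ME : M = (1 + y) * Q * (1 + x).
  have e : (U + V - 1) * (V' * Q * U') = 1.
    rewrite fac -!mulrA [V * _]mulrA VV' mul1r [(1 - _) * _]mulrA mul_fgeom//.
    by rewrite mul1r.
  transitivity (M * ((U + V - 1) * (V' * Q * U'))); first by rewrite e mulr1.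
  have y1 : 1 + y = V' by rewrite addrC subrK.
  have x1 : 1 + x = U' by rewrite addrC subrK.
  by rewrite mulrA MS mul1r x1 y1.
(* By [mX] and [mY] the state maps [U'] and [V'] to the series [1]; subtracting [1] centers every
   coefficient. *)
have cent (b : bool) n : state A (if b then x else y)`[n] = 0.
  have h W : fpsmap (state A) W = 1 -> state A (W - 1)`[n] = 0.
    move=> W1; rewrite fcoefB linearB.
    have -> : state A W`[n] = (1 : fps C)`[n] by rewrite -W1.
    by rewrite !fcoef1; case: eqP => _; rewrite ?state1 ?linear0 ?subrr ?addr0.
  by case: b; exact: h.
have := @state_fgeom_alt _ (fun b : bool => if b then x else y) XY _ cent _ x0.
rewrite -ME => MM.
apply: fpsP => n; rewrite fcoef1; apply: MM => -[] m.
  by rewrite fcoefB fcoef1; apply: gen_algB_nat; exact: resolvent_gen_alg.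
by rewrite fcoefB fcoef1; apply: gen_algB_nat; exact: resolvent_gen_alg.
Qed.

End FreeSum.

(** * Moments of the free convolution *)

Lemma fps_invertible (K : comNzRingType) (f : fps K) : f`[0] = 1 ->
  exists u : fps K, u * f = 1 /\ u`[0] = 1.
Proof.
move=> f0; exists (fgeom (1 - f)).
have e : fgeom (1 - f) * f = 1.
  rewrite mulrC -[X in X * _](subKr 1) mul_fgeom//.
  by rewrite fcoefB fcoef1 f0 subrr.
split=> //; have := congr1 (fun h => h`[0]) e.
by rewrite fcoef0M f0 mulr1 => ->; rewrite fcoef1.
Qed.

(** Applies [free_resolvent] with [psi1 = 1 + t g^2] and [psi2 = b], then Lagrange inversion. The
    computation takes place over [R[i]], where the state has its values, and descends to [R] by
    injectivity of the embedding. *)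
Lemma free_convolution_momentE (R : realType) (t : R) (t0 : 0 < t)
    (mu : probability (measurableTypeR R) R) n :
  is_free_additive_convolution
    (semicircle_prob (two_sqrt_gt0 t0)) (uniform_prob (opp_lt0 t0)) mu ->
  fine (moment mu n) =
    n`!%:R * \sum_(uphalf n <= j < n.+1)
       t ^+ j / (j`! * (1 + j)`!)%:R * (stirling1 (1 + j) (n + 1 - j))%:~R.
Proof.
move=> [A [X [Y [_ _ XY [[csX lawX] [csY lawY] [_ lawS]]]]]].
set T : R[i] := (t%:C)%C.
have [u1 [u1P u10]] : exists u : fps R[i],
    u * (1 + fpsC T * fpsX _ ^+ 2) = 1 /\ u`[0] = 1.
  apply: fps_invertible.
  by rewrite fcoefD fcoef1 fcoefCM expr2 fcoef0XM mulr0 addr0.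
have E0 : (fexp1 T)`[0] = 1 by rewrite /= expr0 (factS 0) divr1.
have [b [bE b0]] := fps_invertible E0.
have [u [uP _]] : exists u : fps R[i],
    u * (b + fpsC T * fpsX _ ^+ 2) = 1 /\ u`[0] = 1.
  apply: fps_invertible.
  by rewrite fcoefD b0 fcoefCM expr2 fcoef0XM mulr0 addr0.
have mX : momsum (fun k => state A (X ^+ k)) u1 = 1.
  apply: (momsum_semicircle u1P).
  - by rewrite expr0 state1.
  (* At [k = 0] the recurrence reads [3 m_1 = 0]. *)
  - rewrite lawX; have := moment_semicircle_rec 0 csX.
    by rewrite !mul0r => /eqP; rewrite mulf_eq0 pnatr_eq0 => /eqP ->.
  - move=> k; rewrite !lawX; have := moment_semicircle_rec k.+1 csX.
    (* The squared radius is [4 t], the constant in the recurrence required of [c]. *)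
    rewrite exprMn sqr_sqrtr ?ltW// addSn -addnS => e.
    move/(congr1 (fun x => (x%:C)%C)): e.
    by rewrite !rmorphM/= !rmorph_nat => ->; ring.
have mY : momsum (fun k => state A (Y ^+ k)) (fexp1 T) = 1.
  rewrite -[RHS](momsum_unif T); apply: eq_shiftsum => k.
  rewrite lawY moment_uniform//; congr (fpsC _ * _).
  by rewrite rmorphM rmorphXn rmorphN fmorphV rmorph_nat.
have mS : momsum (fun k => state A ((X + Y) ^+ k)) u = 1.
  apply: (free_resolvent XY u1P _ _ u10 mX mY).
    by rewrite mulrC; exact: bE.
  by rewrite addrAC [1 + _]addrC addrK addrC.
have := lagrange_inversion uP _ mS n; rewrite fcoef_lagrange_stirling//.
rewrite fcoefD b0 fcoefCM expr2 fcoef0XM mulr0 addr0 => /(_ erefl).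
move/(mulfI _); rewrite lawS pnatr_eq0 => /(_ isT) e; apply: (@complexI R).
rewrite e rmorphM rmorph_nat rmorph_sum; congr (_ * _); apply: eq_bigr => j _.
rewrite [RHS]rmorphM rmorph_int; congr (_ * _).
by rewrite [RHS]rmorphM rmorphXn fmorphV rmorph_nat.
Qed.

Theorem theorem1p2 (R : realType) (n : nat) (t : R) (t0 : 0 < t)
    (mu : probability (measurableTypeR R) R) :
  is_free_additive_convolution
    (semicircle_prob (two_sqrt_gt0 t0)) (uniform_prob (opp_lt0 t0)) mu ->
  moment mu n =
    (n`!%:R * \sum_(uphalf n <= j < n.+1)
       t ^+ j / (j`! * (1 + j)`!)%:R * (stirling1 (1 + j) (n + 1 - j))%:~R)%:E.
Proof.
(* The law of the sum is compactly supported by [has_law], so its moment is finite and [fine] loses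
   nothing. *)
move=> conv; rewrite -(free_convolution_momentE _ conv) fineK//.
case: conv => [A [X [Y [_ _ _ [_ _ [cs _]]]]]].
exact: integrable_fin_num (integrable_expr n cs).
Qed.
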